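(* Let $n\ge1$ and let $G=C_{2n+1}$ be the cycle on $2n+1$ vertices, with cover ideal $J(G)$. Then: (1) $\displaystyle\rho(J(G))=\rho_a(J(G))=\frac{\alpha(J(G))}{\hat{\alpha}(J(G))}=\frac{2n+2}{2n+1}$. (2) $J(G)^{(2nt+2t)}\subset J(G)^{2nt+t}$ for all $t\ge1$.
   Context: The cover ideal $J(G)$ of a graph $G$, over a field $\mathbb{K}$, is the ideal of $\mathbb{K}[x : x\in V(G)]$ generated by the monomials $\prod_{x\in\Gamma}x$, $\Gamma$ a vertex cover of $G$; equivalently $J(G)=\bigcap_{\{x,y\}\in E(G)}(x,y)$. For a homogeneous ideal $I$, $\alpha(I)$ is the minimal degree of a nonzero element of $I$, and $\hat\alpha(I)=\lim_{s\to\infty}\alpha(I^{(s)})/s$ is the Waldschmidt constant. For an ideal $I$ in a Noetherian ring $R$, $I^{(s)}=\bigcap_{P\in\mathrm{Ass}(I)}(I^sR_P\cap R)$ is the $s$-th symbolic power. The resurgence and asymptotic resurgence are $\rho(I)=\sup\{s/t : s,t\in\mathbb{N},\ I^{(s)}\not\subset I^t\}$ and $\rho_a(I)=\sup\{s/t : s,t\in\mathbb{N},\ I^{(sr)}\not\subset I^{tr}\text{ for all } r\gg0\}$, where $\mathbb{N}$ denotes the positive integers. *)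

(* Defs.v *)
From HB Require Import structures.
From mathcomp Require Import all_boot all_order all_algebra.
From mathcomp Require Import all_classical all_reals all_analysis.
(* The notations of mpoly clash with those of MathComp-Analysis. *)
From mathcomp Require Import -(notations) mpoly.

Set Implicit Arguments.
Unset Strict Implicit.
Unset Printing Implicit Defensive.

Import Order.TTheory GRing.Theory Num.Theory.
Import numFieldNormedType.Exports.

Local Open Scope classical_set_scope.
Local Open Scope ring_scope.

Section Ideals.
Variable A : comNzRingType.
Implicit Types (S I J P : set A).

Definition ideal_gen S : set A :=
  [set f | exists (k : nat) (c g : 'I_k -> A),
     (forall i, S (g i)) /\ f = \sum_(i < k) c i * g i].

Definition ideal_mul I J : set A :=
  ideal_gen [set f | exists a b, [/\ I a, J b & f = a * b]].

Definition ideal_exp I (s : nat) : set A := iter s (ideal_mul I) setT.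

(* idealr_closed includes 1 \notin P. *)
Definition prime_ideal P : Prop :=
  idealr_closed (mem P) /\ prime_idealr_closed (mem P).

(* P is the annihilator of the class of some f in A / I. *)
Definition associated_prime I P : Prop :=
  prime_ideal P /\ exists f, P = [set a | I (a * f)].

End Ideals.

Section SymbolicPowers.
Variable A : idomainType.
Implicit Types (I P : set A).

(* A_P and I A_P are realized inside the fraction field of A. *)
Definition localization P : set {fraction A} :=
  [set x | exists a b : A, ~ P b /\ x = tofrac a / tofrac b].

Definition ideal_localization I P : set {fraction A} :=
  [set x | exists (k : nat) (c : 'I_k -> {fraction A}) (g : 'I_k -> A),
     [/\ forall i, localization P (c i), forall i, I (g i) &
         x = \sum_(i < k) c i * tofrac (g i)]].

Definition symbolic_power I (s : nat) : set A :=
  [set f | forall P, associated_prime I P ->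
     ideal_localization (ideal_exp I s) P (tofrac f)].

Definition resurgence (R : realType) I : \bar R :=
  ereal_sup [set x | exists s t : nat,
    [/\ (0 < s)%N, (0 < t)%N,
        ~ symbolic_power I s `<=` ideal_exp I t & x = (s%:R / t%:R)%:E]].

Definition asymptotic_resurgence (R : realType) I : \bar R :=
  ereal_sup [set x | exists s t : nat,
    [/\ (0 < s)%N, (0 < t)%N,
        \forall r \near \oo,
          ~ symbolic_power I (s * r) `<=` ideal_exp I (t * r) &
        x = (s%:R / t%:R)%:E]].

End SymbolicPowers.

Section Polynomials.
Variables (K : fieldType) (m : nat).
Implicit Types (I : set (mpoly m K)) (e : rel 'I_m).

(* The total degree of f != 0 is (msize f).-1; alpha I is 0 if I has no nonzero
   element. *)
Definition alpha I : nat :=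
  xget 0%N [set d | (exists f, [/\ I f, f != 0 & (msize f).-1 = d]) /\
                    forall f, I f -> f != 0 -> (d <= (msize f).-1)%N].

Definition waldschmidt_seq (R : realType) I : nat -> R :=
  fun s => (alpha (symbolic_power I s))%:R / s%:R.

Definition waldschmidt (R : realType) I : R := limn (waldschmidt_seq R I).

Definition vertex_cover e (C : {set 'I_m}) : Prop :=
  forall x y, e x y -> (x \in C) || (y \in C).

Definition cover_ideal e : set (mpoly m K) :=
  ideal_gen [set f | exists C, vertex_cover e C /\
    f = \prod_(x in C) mpolyX K (mnm1 x)].

End Polynomials.

(* ordS is the successor modulo m. *)
Definition cycle_graph (m : nat) : rel 'I_m :=
  [rel x y | (y == ordS x) || (x == ordS y)].

Arguments resurgence {A} R I.
Arguments asymptotic_resurgence {A} R I.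
Arguments waldschmidt_seq {K m} R I s.
Arguments waldschmidt {K m} R I.
Arguments cover_ideal K {m} e.
Arguments cycle_graph m : clear implicits.

(* Main.v *)
Require Import Defs.
From HB Require Import structures.
From mathcomp Require Import all_boot all_order all_algebra.
From mathcomp Require Import all_classical all_reals all_analysis.
From mathcomp Require Import -(notations) mpoly.
From mathcomp Require Import zify ring lra.

(** Write m = 2n+1 and J = J(C_m).

    The argument is about exponents. Localizing at the primes (x_i, x_j) of
    the edges turns J into a prime generated by variables, so for any loopless
    graph the symbolic power J^(s) is spanned by the monomials x^a with
    a_i + a_j >= s on every edge ij ([symbolic_power_cover_ideal]). A monomial
    x^a lies in J^t as soon as t vertex covers can be found that use each
    vertex i at most a_i times altogether. Complementing the covers, this asks
    for t colours, one for each cover, and for an assignment to each vertex i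
    of w_i = t - a_i (or no) colours, adjacent vertices getting disjoint sets.

    On the odd cycle such an assignment exists as soon as w_i + w_{i+1} <= t
    for all i and the total weight is at most nt ([odd_cycle_coloring]): place
    the colours on a circle of length t and give vertex i an arc of length
    w_i. Consecutive arcs are disjoint when the step between their origins
    lies between w_i and t - w_{i+1}; the two bounds sum to W and mt - W over
    the cycle, W being the total weight, so the steps can be chosen with sum
    nt, which closes the walk up after n turns. If (2n+2)t <= (2n+1)s, the
    inequalities a_i + a_{i+1} >= s give W <= nt ([odd_cycle_weight_le]).
    Hence J^(s) is contained in J^t whenever s/t >= (2n+2)/(2n+1), which bounds
    the resurgence from above; the containments of the second part are the
    cases of equality.

    Degrees give the other direction. Summing a_i + a_{i+1} >= s around the
    cycle bounds the degrees in J^(s) from below by ms/2, and constant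
    exponents come within m/2 of this bound; so the Waldschmidt constant is
    m/2. Since alpha(J) = n+1, every nonzero element of J^t has degree at least
    (n+1)t. Comparing the two, J^(sr) is not contained in J^(tr) for large r
    when s/t < (2n+2)/(2n+1), and such fractions approach (2n+2)/(2n+1). *)

Set Implicit Arguments.
Unset Strict Implicit.
Unset Printing Implicit Defensive.

Import Order.TTheory GRing.Theory Num.Theory.
Import numFieldNormedType.Exports.

Local Open Scope classical_set_scope.
Local Open Scope ring_scope.

(** * Ideal powers and localization *)

Section IdealPowers.
Variable A : comNzRingType.
Implicit Types (S I : set A) (f g : A).

Definition is_ideal I : Prop :=
  I 0 /\ forall a u v, I u -> I v -> I (a * u + v).

Lemma is_idealM I a u : is_ideal I -> I u -> I (a * u).
Proof. by move=> [I0 IP] Iu; rewrite -[_ * _]addr0; apply: IP. Qed.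

Lemma is_ideal_sum (T : Type) (r : seq T) (P : pred T) (F : T -> A) I :
  is_ideal I -> (forall i, P i -> I (F i)) -> I (\sum_(i <- r | P i) F i).
Proof.
move=> [I0 IP] IF; elim/big_ind: _ => // u v Iu Iv.
by rewrite -[u]mul1r; apply: IP.
Qed.

Lemma ideal_gen_is_ideal S : is_ideal (ideal_gen S).
Proof.
split; first by exists 0%N, (fun=> 0), (fun=> 0); split; [case | rewrite big_ord0].
move=> a _ _ [k [c [g [Sg ->]]]] [l [d [h [Sh ->]]]].
exists (k + l)%N, (fun i => match fintype.split i with inl i => a * c i | inr i => d i end),
  (fun i => match fintype.split i with inl i => g i | inr i => h i end).
split; first by move=> i; case: (fintype.split i).
rewrite big_split_ord /= mulr_sumr; congr (_ + _); apply: eq_bigr => i _.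
  by rewrite (unsplitK (inl i : 'I_k + 'I_l)) mulrA.
by rewrite (unsplitK (inr i : 'I_k + 'I_l)).
Qed.

Lemma subset_ideal_gen S : S `<=` ideal_gen S.
Proof.
by move=> f Sf; exists 1%N, (fun=> 1), (fun=> f); rewrite big_ord1 mul1r.
Qed.

Lemma ideal_gen_subset S I : is_ideal I -> S `<=` I -> ideal_gen S `<=` I.
Proof.
move=> idI SI _ [k [c [g [Sg ->]]]]; apply: is_ideal_sum => // i _.
by apply: is_idealM => //; apply: SI.
Qed.

Lemma ideal_exp_is_ideal I s : is_ideal (ideal_exp I s).
Proof. by case: s => [|s]; [split | apply: ideal_gen_is_ideal]. Qed.

Lemma ideal_exp_prod I t (g : 'I_t -> A) :
  (forall i, I (g i)) -> ideal_exp I t (\prod_i g i).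
Proof.
elim: t g => [//|t IH] g Ig.
rewrite big_ord_recl; apply: subset_ideal_gen.
by exists (g ord0), (\prod_i g (lift ord0 i)); split=> //; apply: IH.
Qed.

(** Bounding below a valuation on I^t by t times its bound on I; the valuation
    is given by its filtration V. *)
Lemma ideal_exp_filtration (V : nat -> set A) I d t :
  (forall k, is_ideal (V k)) -> V 0%N = setT ->
  (forall i j f g, V i f -> V j g -> V (i + j)%N (f * g)) ->
  I `<=` V d -> ideal_exp I t `<=` V (t * d)%N.
Proof.
move=> idV V0 VM IV; elim: t => [|t IH]; first by rewrite mul0n V0.
apply: ideal_gen_subset => // _ [a [b [Ia Jb ->]]].
by rewrite mulSn; apply: VM; [apply: IV | apply: IH].
Qed.

End IdealPowers.

Section Localization.
Variable A : idomainType.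
Implicit Types (I P : set A) (f : A).

Lemma prime_idealP P : prime_ideal P ->
  [/\ P 0, ~ P 1 & forall a b, ~ P a -> ~ P b -> ~ P (a * b)].
Proof.
have memP x : (x \in mem P) = (x \in P) by [].
move=> [[]]; rewrite !memP => P0 P1 _ PP; split; first exact: set_mem.
  by move=> h; case/negP: P1; apply: mem_set.
move=> a b Pa Pb /mem_set Pab; have := PP a b; rewrite !memP => /(_ Pab).
by case/orP => /set_mem.
Qed.

(** Reduces membership in I A_P to a statement in A, by bringing a sum of
    fractions to a common denominator, which stays outside P. *)
Lemma ideal_localization_denominator I P f : is_ideal I -> prime_ideal P ->
  ideal_localization I P (tofrac f) <-> exists b, ~ P b /\ I (b * f).
Proof.
move=> idI /prime_idealP[P0 P1 PM].
have nz b : ~ P b -> tofrac b != 0.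
  by move=> Pb; rewrite tofrac_eq0; apply/eqP => b0; apply: Pb; rewrite b0.
split; last first.
  move=> [b [Pb Ibf]]; exists 1%N, (fun=> tofrac 1 / tofrac b), (fun=> b * f).
  split=> //; first by exists 1, b.
  by rewrite big_ord1 tofracM tofrac1 mul1r mulKf ?nz.
move=> [k [c [g [Pc Ig]]]].
suff [b [h [Pb Ih ->]]] : exists b h, [/\ ~ P b, I h &
    \sum_(i < k) c i * tofrac (g i) = tofrac h / tofrac b].
  move=> E; exists b; split=> //.
  suff /eqP : tofrac (b * f) = tofrac h by rewrite tofrac_eq => /eqP ->.
  by rewrite tofracM E mulrC divfK ?nz.
elim: k c g Pc Ig => [|k IH] c g Pc Ig.
  exists 1, 0; split=> //; first by case: idI.
  by rewrite big_ord0 tofrac0 mul0r.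
have [b [h [Pb Ih E]]] := IH (c \o lift ord0) (g \o lift ord0)
  (fun i => Pc _) (fun i => Ig _).
have [a [d [Pd cE]]] := Pc ord0.
exists (d * b), ((a * b) * g ord0 + d * h); split; first exact: PM.
  by case: (idI) => _; apply=> //; apply: is_idealM.
rewrite big_ord_recl /= E cE tofracD !tofracM.
by rewrite mulrAC addf_div ?nz // (mulrAC _ _ (tofrac b)) (mulrC (tofrac h)).
Qed.

End Localization.

(** * Monomial weights *)

Section LowCoefficients.
Variable A : idomainType.
Implicit Types p q r : {poly A}.

Definition order_ge d p : Prop := forall j, (j < d)%N -> p`_j = 0.

Lemma order_geMD d r p q : order_ge d p -> order_ge d q -> order_ge d (r * p + q).
Proof.
move=> p0 q0 j jd; rewrite coefD coefM q0 // addr0 big1 // => i _.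
by rewrite p0 ?mulr0 // (leq_ltn_trans (leq_subr _ _)).
Qed.

Lemma order_geM d d' p q :
  order_ge d p -> order_ge d' q -> order_ge (d + d')%N (p * q).
Proof.
move=> p0 q0 j jd; rewrite coefM big1 // => i _.
have [id|di] := ltnP i d; first by rewrite p0 ?mul0r.
by rewrite q0 ?mulr0 //; have := ltn_ord i; lia.
Qed.

(** The lowest coefficients of p and q multiply to the lowest coefficient of
    p q, so by induction those of q below d vanish. *)
Lemma order_ge_cancel d p q : p`_0 != 0 -> order_ge d (p * q) -> order_ge d q.
Proof.
move=> p0 pq0 j; elim/ltn_ind: j => j IH jd.
have := pq0 j jd; rewrite coefM big_ord_recl /= subn0 big1.
  by rewrite addr0 => /eqP; rewrite mulf_eq0 (negPf p0) => /eqP.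
by move=> i _; have ij := ltn_ord i; rewrite IH ?mulr0 //= /bump; lia.
Qed.

End LowCoefficients.

Section Monomials.
Variables (K : fieldType) (m : nat).
Implicit Types (f g : mpoly m K) (a b : multinom m) (S : pred 'I_m).

Definition mnm_of (E : 'I_m -> nat) : multinom m := Multinom [tuple E i | i < m].

Lemma is_ideal_monomials (I : set (mpoly m K)) f : is_ideal I ->
  (forall a, mcoeff a f != 0 -> I (mpolyX K a)) -> I f.
Proof.
move=> idI If; rewrite [f]mpolyE big_seq; apply: is_ideal_sum => // a.
by rewrite mcoeff_msupp -mul_mpolyC => /If; apply: is_idealM.
Qed.

Lemma is_ideal_monomial_le (I : set (mpoly m K)) a b : is_ideal I ->
  (forall i, a i <= b i)%N -> I (mpolyX K a) -> I (mpolyX K b).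
Proof.
move=> idI le_ab Ia.
have -> : b = mnm_add (mnm_of (fun i => b i - a i)%N) a.
  by apply/mnmP => i; rewrite mnmDE mnmE subnK.
by rewrite mpolyXD; apply: is_idealM.
Qed.

Definition weight S a : nat := \sum_(i | S i) a i.

Lemma weight_pred2 x y a : x != y -> weight (pred2 x y) a = (a x + a y)%N.
Proof.
move=> xy; rewrite /weight (bigD1 x) /=; last by rewrite eqxx.
rewrite (big_pred1 y) // => i /=.
by have [->|] := eqVneq i x; rewrite ?(negPf xy) //= andbT.
Qed.

(** The ring morphism x_i |-> x_i T for i in S, x_i |-> x_i otherwise: the
    coefficient of T^j is the part of f of degree j in the variables of S.
    It turns the valuation given by the weight into the order of a
    univariate polynomial. *)
Definition grading S f : {poly mpoly m K} :=
  mmap (polyC \o @mpolyC m K)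
    (fun i => (mpolyX K (mnm1 i))%:P * (if S i then 'X else 1)) f.

Lemma coef_grading S f j a :
  mcoeff a (grading S f)`_j = if weight S a == j then mcoeff a f else 0.
Proof.
have mmap1E b : mmap1 (fun i => (mpolyX K (mnm1 i))%:P * (if S i then 'X else 1)) b
    = (mpolyX K b)%:P * 'X^(weight S b).
  rewrite /mmap1 /weight expr_sum [in RHS]big_mkcond /= mpolyXE_id rmorph_prod.
  rewrite -big_split; apply: eq_bigr => i _.
  by rewrite exprMn rmorphXn /=; case: (S i); rewrite // expr1n.
rewrite /grading /mmap coef_sum raddf_sum /=.
transitivity (\sum_(b <- msupp f) if weight S a == j
    then mcoeff a (mcoeff b f *: mpolyX K b) else 0).
  apply: eq_bigr => b _; rewrite mmap1E mulrA -polyCM coefCM coefXn mcoeffZ.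
  rewrite mul_mpolyC mulr_natr mcoeffMn mcoeffZ mcoeffX.
  have [->|_] := eqVneq b a; last by rewrite mulr0 mul0rn if_same.
  by rewrite eq_sym; case: eqP.
case: eqP => _; last by rewrite big1.
by rewrite [in RHS](mpolyE f) raddf_sum.
Qed.

Lemma gradingD S f g : grading S (f + g) = grading S f + grading S g.
Proof. exact: rmorphD. Qed.

Lemma gradingM S f g : grading S (f * g) = grading S f * grading S g.
Proof. exact: rmorphM. Qed.

(** The d-th power of the prime ideal generated by the variables in S. *)
Definition weight_ge S d : set (mpoly m K) :=
  [set f | forall a, mcoeff a f != 0 -> (d <= weight S a)%N].

Lemma weight_ge_grading S d f :
  weight_ge S d f <-> order_ge d (grading S f).
Proof.
split=> [Vf j jd | gf a fa].
  apply/mpolyP => a; rewrite coef_grading mcoeff0; case: eqP => // wa.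
  by apply/eqP; apply: contraTT jd => /Vf; rewrite wa -leqNgt.
rewrite leqNgt; apply: contra fa => /gf/(congr1 (mcoeff a)).
by rewrite coef_grading eqxx mcoeff0 => ->.
Qed.

Lemma weight_ge_is_ideal S d : is_ideal (weight_ge S d).
Proof.
split=> [a|g u v]; first by rewrite mcoeff0 eqxx.
by rewrite !weight_ge_grading gradingD gradingM; apply: order_geMD.
Qed.

Lemma weight_ge0 S : weight_ge S 0 = setT.
Proof. by rewrite predeqE => f; split. Qed.

Lemma weight_geM S d d' f g :
  weight_ge S d f -> weight_ge S d' g -> weight_ge S (d + d')%N (f * g).
Proof.
by rewrite !weight_ge_grading gradingM; apply: order_geM.
Qed.

(** The powers of a prime generated by variables are primary. *)
Lemma weight_ge_cancel S d (b : mpoly m K) f :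
  ~ weight_ge S 1 b -> weight_ge S d (b * f) -> weight_ge S d f.
Proof.
move=> Vb; have b0 : (grading S b)`_0 != 0.
  by apply/eqP => b0; apply: Vb; apply/weight_ge_grading => -[].
by rewrite !weight_ge_grading gradingM; apply: order_ge_cancel.
Qed.

Lemma weight_ge_monomial S d a :
  weight_ge S d (mpolyX K a) <-> (d <= weight S a)%N.
Proof.
split=> [|da b]; first by apply; rewrite mcoeffX eqxx oner_neq0.
by rewrite mcoeffX; have [<-|] := eqVneq a b; rewrite ?eqxx.
Qed.

(** Primality is the case d = 1 of cancellation. *)
Lemma weight_ge1_prime S : prime_ideal (weight_ge S 1).
Proof.
have memP f : (f \in mem (weight_ge S 1)) = (f \in weight_ge S 1) by [].
have [V0 VP] := weight_ge_is_ideal S 1.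
split; [split|] => [||a u v|u v]; rewrite ?memP.
- exact: mem_set.
- apply/negP => /set_mem; rewrite -mpolyX0 weight_ge_monomial /weight.
  by rewrite big1 // => i _; rewrite mnm0E.
- by move=> /set_mem Vu /set_mem Vv; apply/mem_set/VP.
move=> /set_mem Vuv; have [Vu|Vu] := pselect (weight_ge S 1 u).
  by rewrite mem_set.
by rewrite orbC mem_set //; apply: weight_ge_cancel Vu Vuv.
Qed.

End Monomials.

(** * Symbolic powers of cover ideals *)

Section CoverIdeals.
Variables (K : fieldType) (m : nat) (e : rel 'I_m).
Implicit Types (f g : mpoly m K) (a b : multinom m) (x y : 'I_m).
Local Notation J := (cover_ideal K e).

Lemma prod_cover (C : {set 'I_m}) :
  \prod_(x in C) mpolyX K (mnm1 x) = mpolyX K (mnm_of (fun x => x \in C)).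
Proof.
rewrite mprodXE; congr mpolyX; apply/mnmP => i.
rewrite mnm_sumE mnmE (eq_bigr (fun x => nat_of_bool (x == i))); last first.
  by move=> x _; rewrite mnm1E.
rewrite big_mkcond (bigD1 i) //= eqxx big1 ?addn0; first by case: (i \in C).
by move=> x /negPf->; rewrite if_same.
Qed.

Lemma vertex_cover_mem_cover_ideal (C : {set 'I_m}) :
  vertex_cover e C -> J (mpolyX K (mnm_of (fun x => x \in C))).
Proof.
by move=> eC; rewrite -prod_cover; apply: subset_ideal_gen; exists C.
Qed.

Lemma cover_ideal_is_ideal : is_ideal J.
Proof. exact: ideal_gen_is_ideal. Qed.

(** The support of such an exponent is a vertex cover. *)
Lemma monomial_mem_cover_ideal a :
  (forall x y, e x y -> 0 < a x + a y)%N -> J (mpolyX K a).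
Proof.
move=> ea; pose C := finset (fun x => 0 < a x)%N.
have /(is_ideal_monomial_le cover_ideal_is_ideal) : J (mpolyX K (mnm_of (fun x => x \in C))).
  apply: vertex_cover_mem_cover_ideal => x y /ea; rewrite !inE; lia.
by apply=> i; rewrite mnmE inE; case: (a i).
Qed.

Hypothesis e_irr : irreflexive e.

Lemma edge_neq x y : e x y -> x != y.
Proof. by apply: contraTneq => ->; rewrite e_irr. Qed.

Lemma cover_ideal_edge x y : e x y -> J `<=` weight_ge (pred2 x y) 1.
Proof.
move=> exy; apply: ideal_gen_subset; first exact: weight_ge_is_ideal.
move=> _ [C [eC ->]]; rewrite prod_cover weight_ge_monomial.
rewrite weight_pred2 ?edge_neq // !mnmE.
by case/orP: (eC _ _ exy) => ->; rewrite ?addn1.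
Qed.

Lemma cover_ideal_exp_edge x y t :
  e x y -> ideal_exp J t `<=` weight_ge (pred2 x y) t.
Proof.
move=> exy; rewrite -[X in weight_ge _ X]muln1.
apply: (@ideal_exp_filtration _ (fun d => weight_ge (pred2 x y) d)) => [d|||].
- exact: weight_ge_is_ideal.
- exact: weight_ge0.
- exact: weight_geM.
- exact: cover_ideal_edge.
Qed.

Lemma mem_cover_ideal f :
  (forall x y, e x y -> weight_ge (pred2 x y) 1 f) -> J f.
Proof.
move=> Vf; apply: is_ideal_monomials => [|a fa]; first exact: cover_ideal_is_ideal.
apply: monomial_mem_cover_ideal => x y exy.
by rewrite -weight_pred2 ?edge_neq //; apply: Vf fa.
Qed.

(** The product of the variables off the edge xy. It is a unit in the
    localization at the prime of xy, and multiplying by it satisfies the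
    conditions of all other edges, so it witnesses both that this prime is
    associated and what the localization of J is. *)
Definition off_edge x y : multinom m := mnm_of (fun i => ~~ pred2 x y i).

Lemma off_edge_weight x y : e x y ->
  ~ weight_ge (pred2 x y) 1 (mpolyX K (off_edge x y)).
Proof.
move=> exy; rewrite weight_ge_monomial weight_pred2 ?edge_neq //.
by rewrite !mnmE /= !eqxx orbT.
Qed.

Lemma mul_off_edge_mem x y f : e x y ->
  weight_ge (pred2 x y) 1 f -> J (f * mpolyX K (off_edge x y)).
Proof.
move=> exy Vf; rewrite [f]mpolyE big_seq mulr_suml.
apply: is_ideal_sum => [|b]; first exact: cover_ideal_is_ideal.
rewrite mcoeff_msupp => /Vf; rewrite weight_pred2 ?edge_neq // => bxy.
rewrite -mul_mpolyC -mulrA -mpolyXD.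
apply: is_idealM; first exact: cover_ideal_is_ideal.
apply: monomial_mem_cover_ideal => u v euv; rewrite !mnmDE !mnmE /=.
move: (edge_neq euv) (edge_neq exy) bxy.
case: (eqVneq u x) => [?|_]; case: (eqVneq u y) => [?|_];
  case: (eqVneq v x) => [?|_]; case: (eqVneq v y) => [?|_]; subst;
  by rewrite ?eqxx //=; lia.
Qed.

Lemma edge_prime_associated x y :
  e x y -> associated_prime J (weight_ge (pred2 x y) 1).
Proof.
move=> exy; split; first exact: weight_ge1_prime.
exists (mpolyX K (off_edge x y)); rewrite predeqE => f; split=> [Vf|Jf].
  exact: mul_off_edge_mem.
apply: weight_ge_cancel (off_edge_weight exy) _.
by rewrite mulrC; apply: cover_ideal_edge Jf.
Qed.

(** The other factor provides s variables among x and y; each of them, times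
    one copy of the off-edge monomial, lies in J. *)
Lemma off_edge_multiple_mem x y s a : e x y -> (s <= a x + a y)%N ->
  ideal_exp J s (mpolyX K (off_edge x y) ^+ s * mpolyX K a).
Proof.
move=> exy; elim: s a => [//|s IH] a sa.
suff [z [zxy z0]] : exists z, pred2 x y z /\ (0 < a z)%N.
  pose b := mnm_of (fun i => a i - (i == z))%N.
  have -> : a = mnm_add (mnm1 z) b.
    apply/mnmP => i; rewrite mnmDE mnm1E mnmE eq_sym.
    by case: eqP => [->|_]; rewrite /= ?subnKC ?subn0.
  rewrite exprS mpolyXD mulrACA; apply: subset_ideal_gen.
  exists (mpolyX K (off_edge x y) * mpolyX K (mnm1 z)).
  exists (mpolyX K (off_edge x y) ^+ s * mpolyX K b).
  split=> //.
    rewrite mulrC; apply: mul_off_edge_mem => //.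
    rewrite weight_ge_monomial weight_pred2 ?edge_neq // !mnm1E.
    by case/pred2P: zxy => ->; rewrite eqxx ?addn1.
  apply: IH; rewrite !mnmE; have := edge_neq exy.
  by case/pred2P: zxy z0 => ->; rewrite eqxx; have [->|] := eqVneq x y; lia.
case: (posnP (a x)) => ax; last by exists x; rewrite /= eqxx.
by exists y; rewrite /= eqxx orbT; split=> //; lia.
Qed.

(** An arbitrary associated prime (J : g) need not be identified: g violates
    the condition of some edge, and then (J : g) lies in the prime of this
    edge, so it suffices to clear denominators at the primes of the edges. *)
Theorem symbolic_power_cover_ideal s : symbolic_power J s =
  [set f | forall x y, e x y -> weight_ge (pred2 x y) s f].
Proof.
rewrite predeqE => f; split=> [Sf x y exy | Vf P aP].
  have aP := edge_prime_associated exy.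
  have /ideal_localization_denominator := Sf _ aP.
  case/(_ (ideal_exp_is_ideal _ _) aP.1) => b [Pb /(cover_ideal_exp_edge exy)].
  exact: weight_ge_cancel.
have [P0 P1 _] := prime_idealP aP.1.
apply/ideal_localization_denominator; [exact: ideal_exp_is_ideal|exact: aP.1|].
have [_ [g PE]] := aP.
have [x [y [exy Vg]]] : exists x y, e x y /\ ~ weight_ge (pred2 x y) 1 g.
  apply: contrapT => h; apply: P1; rewrite PE /= mul1r; apply: mem_cover_ideal.
  by move=> x y exy; apply: contrapT => Vg; apply: h; exists x, y.
exists (mpolyX K (off_edge x y) ^+ s); split.
  suff Pv h : P h -> weight_ge (pred2 x y) 1 h.
    move=> /Pv; elim: s {Vf} => [|s IH].
      by rewrite expr0; case: (prime_idealP (weight_ge1_prime K (pred2 x y))).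
    by rewrite exprS => /(weight_ge_cancel (off_edge_weight exy)).
  rewrite PE /= mulrC => /(cover_ideal_edge exy).
  exact: weight_ge_cancel.
rewrite [f]mpolyE big_seq mulr_sumr.
apply: is_ideal_sum => [|b]; first exact: ideal_exp_is_ideal.
rewrite mcoeff_msupp => /(Vf _ _ exy); rewrite weight_pred2 ?edge_neq // => sb.
rewrite -mul_mpolyC mulrCA; apply: is_idealM; first exact: ideal_exp_is_ideal.
exact: off_edge_multiple_mem.
Qed.

End CoverIdeals.

(** * Circular colourings of weighted odd cycles *)

Section OddCycleColourings.

Local Open Scope nat_scope.

Set Implicit Arguments.
Unset Strict Implicit.
Unset Printing Implicit Defensive.

Section Arcs.
Variable t' : nat.
Let t := t'.+1.

(** The k consecutive colours starting at p on a circle of t colours; taking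
    t = t'.+1 makes the projection to residues available. *)
Definition arc (p k : nat) : {set 'I_t} := [set inZp (p + u) | u : 'I_k].

Lemma card_arc p k : (k <= t)%N -> #|arc p k| = k.
Proof.
move=> kt; rewrite card_imset ?card_ord // => u v /(congr1 val) /= /eqP.
rewrite eqn_modDl !modn_small ?(leq_trans (ltn_ord _) kt) // => /eqP.
exact: val_inj.
Qed.

Lemma arc_disjoint p k q l j : (k <= q)%N -> (q + l <= t)%N ->
  j \in arc p k -> j \notin arc (p + q) l.
Proof.
move=> kq qlt /imsetP[u _ ->]; apply/imsetP => -[v _ /(congr1 val) /= /eqP].
have uk := ltn_ord u; have vl := ltn_ord v.
rewrite -addnA eqn_modDl !modn_small; lia.
Qed.

Lemma arc_mod p q k : p = q %[mod t] -> arc p k = arc q k.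
Proof.
move=> pq; apply: eq_imset => u; apply: val_inj => /=.
by rewrite -modnDml pq modnDml.
Qed.

End Arcs.

(** The step sizes of a walk can be adjusted one by one between their lower
    and upper bounds, so the walk can end at any N between the two sums. *)
Lemma lattice_path m (f g : nat -> nat) N :
  (forall i, i < m -> f i <= g i)%N ->
  (\sum_(0 <= i < m) f i <= N <= \sum_(0 <= i < m) g i)%N ->
  exists p : nat -> nat, [/\ p 0%N = 0%N, p m = N &
    forall i, (i < m)%N -> (p i + f i <= p i.+1 <= p i + g i)%N].
Proof.
move=> fg /andP[fN Ng].
pose U k := \sum_(0 <= i < k) g i; pose L k := \sum_(0 <= i < k) f i.
(* Take the largest steps for as long as N can still be reached with the
   smallest steps, then the smallest ones. *)
exists (fun k => minn (U k) (N - L m + L k)); rewrite /U /L; split.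
- by rewrite !(big_geq (leqnn 0)) min0n.
- by rewrite subnK // (minn_idPr Ng).
move=> i im; rewrite !(@big_nat_recr _ _ _ i) //=.
have := fg _ im; move: (\sum_(0 <= _ < i) _) (\sum_(0 <= _ < i) _) => a b; lia.
Qed.

Lemma period_mod (T : Type) (w : nat -> T) m i :
  (forall i, w (i + m) = w i) -> w (i %% m) = w i.
Proof.
move=> w_per; rewrite [in RHS](divn_eq i m); elim: (i %/ m) => [|q IH].
  by rewrite add0n.
by rewrite mulSn [m + _]addnC addnAC w_per.
Qed.

Section PeriodicSums.
Variables (m : nat) (w : nat -> nat).
Hypothesis w_per : forall i, w (i + m) = w i.

Lemma sum_period_shift k : \sum_(0 <= i < m) w (k + i) = \sum_(0 <= i < m) w i.
Proof.
elim: k => [|k <-]; first exact: eq_bigr.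
case: m w_per => [|m'] per; first by rewrite !big_nil.
rewrite big_nat_recr //= [RHS]big_nat_recl //= addn0 addSnnS per addnC.
by congr addn; apply: eq_bigr => i _; rewrite addnS.
Qed.

End PeriodicSums.

Lemma sum_pairs_le n (w : nat -> nat) t :
  (forall i, w i + w i.+1 <= t)%N -> (\sum_(0 <= i < 2 * n) w i <= n * t)%N.
Proof.
move=> wt; elim: n => [|n IH]; first by rewrite big_nil.
rewrite mulnS !big_nat_recr //=.
by have := wt (2 * n)%N; lia.
Qed.

Section OddCycle.
Variables (n : nat) (w a : nat -> nat) (s t : nat).
Let m := (2 * n + 1)%N.

(** If every weight is positive, truncation plays no part and one sums
    w_i + w_{i+1} <= 2t - s over the cycle. If some weight vanishes, the other
    2n vertices form a path covered by n disjoint edges, each of weight at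
    most t. *)
Lemma odd_cycle_weight_le : (forall i, a (i + m) = a i) ->
  (forall i, s <= a i + a i.+1)%N -> ((2 * n + 2) * t <= m * s)%N ->
  (\sum_(0 <= i < m) (t - a i) <= n * t)%N.
Proof.
move=> a_per sa st.
have ts : (t <= s)%N by move: st; rewrite /m; nia.
pose r i := (t - a i)%N.
have r_per i : r (i + m)%N = r i by rewrite /r a_per.
have [[k rk0]|r_pos] := pselect (exists k, r k = 0%N).
  rewrite -(sum_period_shift r_per k) /m addn1 big_nat_recl // addn0 rk0 add0n.
  by apply: sum_pairs_le => i; rewrite /r !addnS; have := sa (k + i).+1; lia.
rewrite -(leq_pmul2l (isT : (0 < 2)%N)) mul2n -addnn.
rewrite -{2}(sum_period_shift r_per 1) -big_split /=.
have wi i : (r i + r (1 + i) <= 2 * t - s)%N.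
  have := sa i; rewrite /r add1n.
  have : r i <> 0%N by move=> h; apply: r_pos; exists i.
  have : r i.+1 <> 0%N by move=> h; apply: r_pos; exists i.+1.
  rewrite /r; lia.
apply: (@leq_trans (\sum_(0 <= i < m) (2 * t - s))); first by apply: leq_sum => i _; apply: wi.
rewrite sum_nat_const_nat subn0; move: st; rewrite /m; nia.
Qed.

(** Arcs on a circle of t colours, placed along a walk that makes n turns
    around the circle while going once around the cycle. *)
Lemma odd_cycle_coloring : (0 < t)%N -> (forall i, w (i + m) = w i) ->
  (forall i, w i + w i.+1 <= t)%N -> (\sum_(0 <= i < m) w i <= n * t)%N ->
  exists A : nat -> {set 'I_t}, [/\ forall i, A (i + m)%N = A i,
    forall i, #|A i| = w i & forall i j, j \in A i -> j \notin A i.+1].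
Proof.
case: t => // t' _ w_per wt W.
have := @lattice_path m w (fun i => t'.+1 - w i.+1)%N (n * t'.+1).
case=> [i _||p [p0 pm pS]]; first by have := wt i; lia.
  rewrite W /=.
  have : (\sum_(0 <= i < m) (t'.+1 - w i.+1) + \sum_(0 <= i < m) w (1 + i)
         = m * t'.+1)%N.
    rewrite -big_split /= -{2}[m]subn0 -sum_nat_const_nat; apply: eq_bigr => i _.
    by rewrite add1n subnK //; have := wt i; lia.
  rewrite (sum_period_shift w_per); move: W; rewrite /m; lia.
exists (fun i => arc t' (p (i %% m)) (w i)); split=> [i|i|i j].
- by rewrite modnDr w_per.
- by rewrite card_arc //; have := wt i; lia.
have m0 : (0 < m)%N by rewrite /m addn1.
have im : (i %% m < m)%N by rewrite ltn_mod.
have -> : arc t' (p (i.+1 %% m)) (w i.+1) = arc t' (p (i %% m).+1) (w i.+1).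
  apply: arc_mod; rewrite -addn1 -modnDml addn1.
  have [lt|ge] := ltnP (i %% m).+1 m; first by rewrite [((_).+1 %% m)%N]modn_small.
  have -> : (i %% m).+1 = m by apply/eqP; rewrite eqn_leq im ge.
  by rewrite modnn p0 pm modnMl mod0n.
have := pS _ im; have wS : w (i %% m).+1 = w i.+1.
  by rewrite -(period_mod (i %% m).+1 w_per) -addn1 modnDml addn1 (period_mod _ w_per).
rewrite wS (period_mod _ w_per) => /andP[lo hi].
rewrite -(subnKC (leq_trans (leq_addr _ _) lo)); apply: arc_disjoint; last 1 first.
all: have := wt i; lia.
Qed.

End OddCycle.

End OddCycleColourings.

(** * Initial degrees, and the cover ideal of an odd cycle *)

Section Alpha.
Variables (K : fieldType) (m : nat).
Implicit Types (I : set (mpoly m K)).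

(** Degrees are well-ordered, so the default value in the definition of alpha
    is taken only when I has no nonzero element. *)
Lemma alpha_spec I f : I f -> f != 0 ->
  (exists g, [/\ I g, g != 0 & (msize g).-1 = alpha I]) /\
  forall g, I g -> g != 0 -> (alpha I <= (msize g).-1)%N.
Proof.
move=> If f0.
pose Q := [pred d | `[< exists g, [/\ I g, g != 0 & (msize g).-1 = d] >]].
have exQ : exists d, Q d by exists (msize f).-1; apply/asboolP; exists f.
suff : [set d | (exists g, [/\ I g, g != 0 & (msize g).-1 = d]) /\
  forall g, I g -> g != 0 -> (d <= (msize g).-1)%N] (alpha I) by [].
apply: xgetPex; case: (ex_minnP exQ) => d /asboolP Qd min_d.
by exists d; split=> // g Ig g0; apply: min_d; apply/asboolP; exists g.
Qed.

Lemma alpha_le I a : I (mpolyX K a) -> (alpha I <= mdeg a)%N.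
Proof.
move=> Ia.
have a0 : mpolyX K a != 0 by rewrite -msize_poly_eq0 msizeX.
by have [_ /(_ _ Ia a0)] := alpha_spec Ia a0; rewrite msizeX.
Qed.

(** The factor e allows half-integral bounds on the degree. *)
Lemma alpha_ge I a d e : I (mpolyX K a) ->
  (forall f b, I f -> mcoeff b f != 0 -> (d <= e * mdeg b)%N) ->
  (d <= e * alpha I)%N.
Proof.
move=> Ia dI.
have a0 : mpolyX K a != 0 by rewrite -msize_poly_eq0 msizeX.
have [[g [Ig g0 <-]] _] := alpha_spec Ia a0.
by rewrite -(mlead_deg g0); apply: dI Ig _; rewrite -mcoeff_msupp mlead_supp.
Qed.

End Alpha.

Section Cycle.
Variables (K : fieldType) (n : nat).
Hypothesis n1 : (1 <= n)%N.
Local Notation m := (2 * n + 1)%N.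
Local Notation J := (cover_ideal K (cycle_graph m)).
Implicit Types (a b : multinom m).

Lemma cycle_irr : irreflexive (cycle_graph m).
Proof.
move=> x; rewrite /cycle_graph /= orbb; apply/negP => /eqP /(congr1 val) /=.
have := ltn_ord x; have [xm|] := ltnP x.+1 m; first by rewrite modn_small; lia.
move=> h1 h2; have -> : x.+1 = m by lia.
by rewrite modnn; lia.
Qed.

Lemma cycle_edge (x : 'I_m) : cycle_graph m x (ordS x).
Proof. by rewrite /cycle_graph /= eqxx. Qed.

Lemma sum_edges a : (\sum_x (a x + a (ordS x)) = 2 * mdeg a)%N.
Proof.
rewrite big_split /= mdegE [RHS]mul2n -addnn; congr addn.
rewrite [RHS](reindex (@ordS m)) //; exact/onW_bij/ordS_bij.
Qed.

Lemma symbolic_power_cycle s f : symbolic_power J s f <->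
  forall a, mcoeff a f != 0 -> forall x, (s <= a x + a (ordS x))%N.
Proof.
rewrite (symbolic_power_cover_ideal K cycle_irr); split=> [Sf a fa x|Sf x y].
  have exy := cycle_edge x.
  by rewrite -weight_pred2 ?(edge_neq cycle_irr) //; apply: Sf fa.
move=> exy a fa; rewrite weight_pred2 ?(edge_neq cycle_irr) //.
by case/orP: exy => /eqP->; last rewrite addnC; apply: Sf fa _.
Qed.

Lemma symbolic_power_cycle_monomial s a :
  symbolic_power J s (mpolyX K a) <-> forall x, (s <= a x + a (ordS x))%N.
Proof.
rewrite symbolic_power_cycle; split=> [|sa b]; last first.
  by rewrite mcoeffX; have [<-|] := eqVneq a b; rewrite ?eqxx.
by apply; rewrite mcoeffX eqxx oner_neq0.
Qed.

(** Each colour gives a vertex cover, namely the vertices that do not have this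
    colour; vertex x occurs in t - w_x <= a_x of these t covers. *)
Lemma monomial_mem_ideal_exp s t a :
  (forall x, s <= a x + a (ordS x))%N -> ((2 * n + 2) * t <= m * s)%N ->
  ideal_exp J t (mpolyX K a).
Proof.
case: t => [//|t] sa st.
have m0 : (0 < m)%N by rewrite addn1.
pose v i : 'I_m := Ordinal (ltn_pmod i m0).
have vS i : v i.+1 = ordS (v i).
  by apply: val_inj; rewrite /= -[i.+1]addn1 -[(i %% m).+1]addn1 modnDml.
have v_per i : v (i + m)%N = v i by apply: val_inj; rewrite /= modnDr.
pose w i := (t.+1 - a (v i))%N.
have w_per i : w (i + m)%N = w i by rewrite /w v_per.
have ts : (t.+1 <= s)%N by move: st; nia.
have wt i : (w i + w i.+1 <= t.+1)%N.
  by have := sa (v i); rewrite /w vS; lia.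
have W : (\sum_(0 <= i < m) w i <= n * t.+1)%N.
  apply: (@odd_cycle_weight_le n (fun i => a (v i)) s) => // i.
    by rewrite v_per.
  by rewrite vS.
have [A [A_per cardA disjA]] := odd_cycle_coloring (ltn0Sn t) w_per wt W.
pose C j : {set 'I_m} := finset (fun x : 'I_m => j \notin A x).
have coverC j : vertex_cover (cycle_graph m) (C j).
  suff cov (x : 'I_m) : (x \in C j) || (ordS x \in C j).
    by move=> x y /orP[] /eqP ->; rewrite // orbC.
  rewrite !inE /= (period_mod _ A_per) -implyNb negbK.
  by apply/implyP; apply: disjA.
have := ideal_exp_prod (fun j => vertex_cover_mem_cover_ideal K (coverC j)).
rewrite mprodXE; apply: is_ideal_monomial_le; first exact: ideal_exp_is_ideal.
move=> x; rewrite mnm_sumE.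
have -> : (\sum_(j < t.+1) mnm_of (fun x => x \in C j) x = #|~: A x|)%N.
  rewrite -sum1_card [RHS]big_mkcond; apply: eq_bigr => j _.
  by rewrite mnmE !inE; case: (j \in A x).
have := cardsC (A x); rewrite cardA card_ord /w.
have -> : v x = x by apply: val_inj; rewrite /= modn_small.
lia.
Qed.

Lemma symbolic_power_subset_ideal_exp s t : ((2 * n + 2) * t <= m * s)%N ->
  symbolic_power J s `<=` ideal_exp J t.
Proof.
move=> st f /symbolic_power_cycle Sf.
apply: is_ideal_monomials => [|a /Sf sa]; first exact: ideal_exp_is_ideal.
exact: monomial_mem_ideal_exp st.
Qed.

Lemma symbolic_power_degree s f a :
  symbolic_power J s f -> mcoeff a f != 0 -> (m * s <= 2 * mdeg a)%N.
Proof.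
move=> /symbolic_power_cycle Sf fa; rewrite -sum_edges.
rewrite -[m in (m * _)%N]card_ord -sum_nat_const.
by apply: leq_sum => x _; apply: Sf.
Qed.

Lemma cover_ideal_degree f a : J f -> mcoeff a f != 0 -> (n.+1 <= mdeg a)%N.
Proof.
move=> Jf fa.
have Sf : symbolic_power J 1 f.
  apply/symbolic_power_cycle => b fb x; have exy := cycle_edge x.
  rewrite -weight_pred2 ?(edge_neq cycle_irr) //.
  by apply: cover_ideal_edge Jf _ fb => //; exact: cycle_irr.
by have := symbolic_power_degree Sf fa; lia.
Qed.

Lemma ideal_exp_degree t f a :
  ideal_exp J t f -> mcoeff a f != 0 -> (t * n.+1 <= mdeg a)%N.
Proof.
have -> : mdeg a = weight predT a by rewrite mdegE.
suff /[apply] : ideal_exp J t `<=` weight_ge predT (t * n.+1)%N by apply.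
apply: (@ideal_exp_filtration _ (fun d => weight_ge predT d)) => [d|||].
- exact: weight_ge_is_ideal.
- exact: weight_ge0.
- exact: weight_geM.
by move=> g Jg b gb; rewrite /weight -mdegE; apply: cover_ideal_degree gb.
Qed.

Lemma const_mem_symbolic_power s :
  symbolic_power J s (mpolyX K (mnm_of (fun=> uphalf s))).
Proof. by apply/symbolic_power_cycle_monomial => x; rewrite !mnmE; lia. Qed.

Lemma mdeg_const d : mdeg (mnm_of (fun _ : 'I_m => d)) = (m * d)%N.
Proof.
rewrite mdegE -[m in RHS]card_ord -sum_nat_const.
by apply: eq_bigr => x _; rewrite mnmE.
Qed.

(** The monomial with constant exponent ceil(s/2) has too small a degree. *)
Lemma symbolic_power_not_subset s t : (m * s.+1 < 2 * n.+1 * t)%N ->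
  ~ symbolic_power J s `<=` ideal_exp J t.
Proof.
move=> st /(_ _ (const_mem_symbolic_power s)) /ideal_exp_degree.
move=> /(_ (mnm_of (fun=> uphalf s))); rewrite mcoeffX eqxx oner_neq0 => /(_ isT).
by rewrite mdeg_const; nia.
Qed.

(** The even vertices 0, 2, ..., 2n form a cover of size n+1. *)
Lemma alpha_cycle : alpha J = n.+1.
Proof.
pose c := mnm_of (fun x : 'I_m => ~~ odd x).
have Jc : J (mpolyX K c).
  apply: monomial_mem_cover_ideal => x y.
  suff cov (z : 'I_m) : (0 < c z + c (ordS z))%N.
    by case/orP => /eqP ->; rewrite // addnC.
  rewrite !mnmE /=; have [zm|mz] := ltnP z.+1 m.
    by rewrite modn_small //=; case: (odd z).
  have -> : z.+1 = m by apply/eqP; rewrite eqn_leq mz ltn_ord.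
  by rewrite modnn; case: (odd z).
apply/eqP; rewrite eqn_leq; apply/andP; split.
  apply: leq_trans (alpha_le Jc) _; rewrite mdegE.
  rewrite (eq_bigr (fun x : 'I_m => nat_of_bool (~~ odd x))); last first.
    by move=> x _; rewrite mnmE.
  rewrite -(big_mkord xpredT (fun i => nat_of_bool (~~ odd i))) addn1.
  elim: (n) => [|k IH]; first by rewrite big_nat1.
  rewrite mulnS big_nat_recr //= big_nat_recr //=; move: IH; case: (odd (2 * k)) => /=; lia.
rewrite -[alpha J]mul1n; apply: alpha_ge Jc _ => f b Jf fb.
by rewrite mul1n; apply: cover_ideal_degree fb.
Qed.

Lemma alpha_symbolic_power s :
  (m * s <= 2 * alpha (symbolic_power J s) <= m * s.+1)%N.
Proof.
have Sc := const_mem_symbolic_power s; apply/andP; split.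
  by apply: alpha_ge Sc _ => f b; apply: symbolic_power_degree.
by have := alpha_le Sc; rewrite mdeg_const; nia.
Qed.

End Cycle.

(** * Resurgence and Waldschmidt constant *)

Lemma ereal_sup_approached (R : realType) (X : set (\bar R)) (c : R) :
  (forall x, X x -> (x <= c%:E)%E) ->
  (forall k, X (c - k.+1%:R^-1)%:E) -> ereal_sup X = c%:E.
Proof.
move=> Xc cX; apply/eqP; rewrite eq_le; apply/andP; split.
  by apply: ge_ereal_sup => x /Xc.
apply/lee_addgt0Pr => eps eps0.
have [k _ /(_ k (leqnn k)) /= kE] := near_infty_natSinv_lt (PosNum eps0).
apply: le_trans (leeD2r _ (ereal_sup_ubound (cX k))).
by rewrite -EFinD lee_fin -addrA lerDl addrC subr_ge0; exact: ltW.
Qed.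

(** A ratio s/t counted asymptotically is also the ratio of sr and tr. *)
Lemma asymptotic_resurgence_le (R : realType) (A : idomainType) (I : set A) :
  (asymptotic_resurgence R I <= resurgence R I)%E.
Proof.
apply: ereal_sup_le => _ [s [t [s0 t0 [N _ NP] ->]]].
have sN : (0 < N.+1)%N by [].
exists (s * N.+1)%N, (t * N.+1)%N; split; rewrite ?muln_gt0 ?s0 ?t0 //.
  by apply: NP => /=.
by rewrite !natrM -mulf_div divff ?mulr1 // pnatr_eq0.
Qed.

Section CycleInvariants.
Variables (R : realType) (K : fieldType) (n : nat).
Hypothesis n1 : (1 <= n)%N.
Local Notation m := (2 * n + 1)%N.
Local Notation J := (cover_ideal K (cycle_graph m)).
Local Notation c := ((2 * n + 2)%:R / m%:R : R).

Lemma waldschmidt_cycle : waldschmidt_seq R J @ \oo --> (m%:R / 2 : R).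
Proof.
rewrite -cvg_shiftS.
apply: (@squeeze_cvgr _ _ _ _ (fun=> m%:R / 2) (fun s => m%:R / 2 + m%:R / 2 * harmonic s)).
- near=> s; have /andP[] := alpha_symbolic_power K n1 s.+1.
  rewrite -!(ler_nat R) !natrM => lo hi.
  have s0 : 0 < s.+1%:R :> R by rewrite ltr0n.
  rewrite /waldschmidt_seq /= ler_pdivlMr // ler_pdivrMr //.
  have -> : (m%:R / 2 + m%:R / 2 * s.+1%:R^-1) * s.+1%:R = m%:R * s.+2%:R / 2 :> R.
    by rewrite mulrDl divfK ?gt_eqF // [s.+2%:R](natrD _ 1 s.+1); field.
  by apply/andP; split; lra.
- exact: cvg_cst.
rewrite -[X in _ --> X]addr0 -[X in _ --> _ + X](mulr0 (m%:R / 2)).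
apply: cvgD; first exact: cvg_cst.
by apply: cvgM; [exact: cvg_cst | exact: cvg_harmonic].
Unshelve. all: by end_near.
Qed.

Lemma alpha_waldschmidt_cycle : (alpha J)%:R / waldschmidt R J = c.
Proof.
rewrite /waldschmidt (cvg_lim _ waldschmidt_cycle) ?alpha_cycle //.
have m0 : m%:R != 0 :> R by rewrite pnatr_eq0 addn1.
have -> : (2 * n + 2)%:R = 2 * n.+1%:R :> R by rewrite -natrM; congr _%:R; lia.
by rewrite invf_div mulrCA mulrA.
Qed.

Lemma resurgence_cycle_le : (resurgence R J <= c%:E)%E.
Proof.
apply: ge_ereal_sup => _ [s [t [s0 t0 Jst ->]]]; rewrite lee_fin.
have [st|st] := leqP ((2 * n + 2) * t) (m * s).
  by case: Jst; apply: symbolic_power_subset_ideal_exp.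
rewrite ler_pdivrMr ?ltr0n // mulrAC ler_pdivlMr ?ltr0n ?addn1 //.
by rewrite -!natrM ler_nat; lia.
Qed.

Lemma asymptotic_resurgence_cycle : asymptotic_resurgence R J = c%:E.
Proof.
apply: ereal_sup_approached => [x Xx|k].
  apply: le_trans resurgence_cycle_le; apply: le_trans (asymptotic_resurgence_le _ _).
  exact: ereal_sup_ubound.
have m0 : m%:R != 0 :> R by rewrite pnatr_eq0 addn1.
(* The ratio of these two numbers is (2n+2)/(2n+1) - 1/(k+1). *)
exists ((2 * n + 2) * k.+1 - m)%N, (m * k.+1)%N; split; [lia|lia| |].
  exists 1%N => // r /= r0; apply: symbolic_power_not_subset => //.
  have -> : ((2 * n + 2) * k.+1 - m = m * k + k.+1)%N by nia.
  by rewrite -[(m * k.+1 * r)%N]mulnA [in ltnRHS]mulnCA ltn_pmul2l ?addn1 //; nia.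
rewrite natrB; last by nia.
by rewrite !natrM mulrBl -mulf_div divff ?pnatr_eq0 // mulr1 invfM mulrA divff // mul1r.
Qed.

Lemma resurgence_cycle : resurgence R J = c%:E.
Proof.
apply/eqP; rewrite eq_le resurgence_cycle_le -asymptotic_resurgence_cycle.
exact: asymptotic_resurgence_le.
Qed.

End CycleInvariants.

Theorem theorem4p7 (R : realType) (K : fieldType) (n : nat) (hn : (1 <= n)%N) :
  let J := cover_ideal K (cycle_graph (2 * n + 1)) in
  [/\ cvgn (waldschmidt_seq R J),
      [/\ resurgence R J = asymptotic_resurgence R J,
          asymptotic_resurgence R J = ((alpha J)%:R / waldschmidt R J)%:E &
          (alpha J)%:R / waldschmidt R J = (2 * n + 2)%:R / (2 * n + 1)%:R] &
      forall t : nat, (1 <= t)%N ->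
        symbolic_power J (2 * n * t + 2 * t) `<=` ideal_exp J (2 * n * t + t)].
Proof.
split; first by apply: cvgP; apply: waldschmidt_cycle.
  by rewrite resurgence_cycle // asymptotic_resurgence_cycle // alpha_waldschmidt_cycle.
by move=> t _; apply: symbolic_power_subset_ideal_exp => //; nia.
Qed.
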